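(* Consider the independent block-fading binary symmetric wiretap channel with parameters $q_1,q_1^*\in[0,1]$ satisfying $q_1\ge q_1^*$, $q_2=1-q_1$, $q_2^*=1-q_1^*$, and crossover probabilities satisfying $p_1\le p_1^*\le p_2\le p_2^*\le 0.5$. Its secrecy capacity with channel state information available only at the decoders satisfies $$C^s_{\textrm{CSI-D}}\ge [H(p_1^* )-H(p_1)]\,q_1+[H(p_2^* )-H(p_2)]\,q_2^*+[H(p_2)-H(p_1^* )]\,(q_1-q_1^* ).$$
   Context: $H(p)=-p\log_2 p-(1-p)\log_2(1-p)$ is the binary entropy function, and BSC$(p)$ denotes the binary symmetric channel with crossover probability $p$. Independent block-fading binary symmetric wiretap channel: the transmitter sends $NB$ binary symbols $X_{1:NB}$ organized in $B$ fading blocks of length $N$. Each block $k$ has a main-channel state $S_k\in\{1,2\}$ with $\Pr(S_k=1)=q_1$ and an eavesdropper-channel state $S^*_k\in\{1,2\}$ with $\Pr(S_k^*=1)=q_1^*$; all these states are mutually independent (across blocks and between the two channels) and constant within a block. Within block $k$, the legitimate receiver observes the output $Y$ of $N$ independent uses of BSC$(p_{S_k})$, and the eavesdropper observes the output $Z$ of $N$ independent uses of BSC$(p^*_{S^*_k})$. Let $\mathsf{S}$ denote all the state realizations $(S_k,S_k^* )_{k=1}^B$. A code consists of a (possibly randomized) encoder $X_{1:NB}=f(\mathsf{M})$ of a uniformly distributed message $\mathsf{M}$, which knows only the state distributions (not the realizations), and a decoder $\hat{\mathsf{M}}=g(Y_{1:NB},\mathsf{S})$; its rate is $\frac{1}{NB}\log_2$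 of the message-set size. A rate $R$ is achievable if there are such codes of rate at least $R$ (asymptotically) with $N,B\to\infty$ such that $\Pr\{\mathsf{M}\ne\hat{\mathsf{M}}\}\to0$ and $\frac{1}{NB}I(\mathsf{M};Z_{1:NB}\mid\mathsf{S})\to 0$. $C^s_{\textrm{CSI-D}}$ is the supremum of achievable rates. *)

(* Defs.v *)
From HB Require Import structures.
From mathcomp Require Import all_boot all_order all_algebra.
From mathcomp Require Import all_classical all_reals all_analysis.
Set Implicit Arguments. Unset Strict Implicit. Unset Printing Implicit Defensive.
Import Order.TTheory GRing.Theory Num.Theory.
Local Open Scope ring_scope.

(* base-2 logarithm; note ln 0 = 0 in mathcomp-analysis, so 0 * log2 0 = 0 *)
Definition log2 {R : realType} (x : R) : R := ln x / ln 2.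

Definition Hb {R : realType} (p : R) : R :=
  - p * log2 p - (1 - p) * log2 (1 - p).

(* Conditional mutual information I(A;B|C) of a joint pmf P on A * B * C
   (terms with P a b c = 0 contribute 0). *)
Definition cond_mutual_info {R : realType} (A B C : finType)
  (P : A -> B -> C -> R) : R :=
  \sum_(a : A) \sum_(b : B) \sum_(c : C)
    P a b c * log2 (P a b c * (\sum_(a' : A) \sum_(b' : B) P a' b' c)
                     / ((\sum_(b' : B) P a b' c) * (\sum_(a' : A) P a' b c))).

Definition bsc {R : realType} (p : R) (b y : bool) : R :=
  if y == b then 1 - p else p.

(* NB binary symbols organized in B blocks of length N: symbol j of block k *)
Definition word (N B : nat) := {ffun 'I_B * 'I_N -> bool}.

(* fading-state sequence of one channel: true = state 1, false = state 2 *)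
Definition states (B : nat) := {ffun 'I_B -> bool}.

Definition state_prob {R : realType} (q1 : R) (B : nat) (s : states B) : R :=
  \prod_(k < B) (if s k then q1 else 1 - q1).

Definition block_bsc {R : realType} (p1 p2 : R) (N B : nat) (s : states B)
  (x y : word N B) : R :=
  \prod_(i : 'I_B * 'I_N) bsc (if s i.1 then p1 else p2) (x i) (y i).

(* randomized encoder: a stochastic map from messages to channel inputs
   (it does not depend on the state realizations) *)
Definition is_encoder {R : realType} (N B K : nat)
  (enc : 'I_K -> word N B -> R) : Prop :=
  forall m, (forall x, 0 <= enc m x) /\ \sum_(x : word N B) enc m x = 1.

Section Code.
Variables (R : realType) (p1 p2 p1s p2s q1 q1s : R).

(* Pr{M <> Mhat}, M uniform on 'I_K, decoder g(Y, S) with S = (main, eve) states *)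
Definition error_prob (N B K : nat) (enc : 'I_K -> word N B -> R)
  (g : word N B -> states B * states B -> 'I_K) : R :=
  \sum_(m : 'I_K) \sum_(s : states B * states B) \sum_(x : word N B)
    \sum_(y : word N B)
      K%:R^-1 * state_prob q1 s.1 * state_prob q1s s.2 * enc m x
        * block_bsc p1 p2 s.1 x y * (g y s != m)%:R.

Definition MZS_pmf (N B K : nat) (enc : 'I_K -> word N B -> R)
  (m : 'I_K) (z : word N B) (s : states B * states B) : R :=
  K%:R^-1 * state_prob q1 s.1 * state_prob q1s s.2 *
    \sum_(x : word N B) enc m x * block_bsc p1s p2s s.2 x z.

Definition leakage (N B K : nat) (enc : 'I_K -> word N B -> R) : R :=
  cond_mutual_info (MZS_pmf enc).

(* R0 achievable: for every eps > 0 and all thresholds, there is a code with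
   N, B beyond the thresholds, rate >= R0 - eps, error <= eps and
   normalized leakage <= eps  (equivalent to the sequence formulation
   with N, B -> oo). *)
Definition achievable (R0 : R) : Prop :=
  forall eps : R, 0 < eps -> forall N0 B0 : nat,
  exists (N B K : nat) (enc : 'I_K -> word N B -> R)
         (g : word N B -> states B * states B -> 'I_K),
    [/\ (N0 <= N)%N, (B0 <= B)%N, (0 < K)%N & is_encoder enc] /\
    [/\ R0 - eps <= log2 (K%:R : R) / (N * B)%:R,
        error_prob enc g <= eps &
        leakage enc / (N * B)%:R <= eps].

Definition Cs_CSID : \bar R := ereal_sup [set r%:E | r in [set r | achievable r]].

End Code.

(* Main.v *)
Require Import Defs.
From HB Require Import structures.
From mathcomp Require Import all_boot all_order all_algebra.
From mathcomp Require Import all_classical all_reals all_analysis.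
From mathcomp Require Import ring lra.
Import Order.TTheory GRing.Theory Num.Theory.
Local Open Scope ring_scope.

(* Expanding the bound gives
   [q1s Hb p1s + (1 - q1s) Hb p2s - q1 Hb p1 - (1 - q1) Hb p2], that is
   I(X;Y|S) - I(X;Z|S) for uniform inputs, so the classical wiretap code works:
   a random codebook of [K] bins of [L] independent uniform codewords, where a
   message is sent as a random word of its bin. The log-likelihoods of the two
   channels concentrate (Chebyshev, over noise and states). Threshold decoding
   then succeeds on average if [log (K L)] is below the capacity of the main
   channel. The leakage is at most the average divergence of the
   eavesdropper's output, given the message, from the uniform law. By concavity
   of ln its mean over codebooks is at most
   [E ln (1 + #|word N B| W(Z|X) / L)], which is o(n) once [log L] exceeds the
   capacity of the eavesdropper's channel. *)

Set Implicit Arguments.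
Unset Strict Implicit.

(** * Expectations under product laws *)

Section ProductExpectation.
Variables (R : comNzRingType) (I T : finType) (P : I -> T -> R).
Hypothesis P1 : forall i, \sum_x P i x = 1.

(** Independence of the coordinates. Factors equal to 1 away from one or two coordinates give the
    next expectations. *)
Lemma ffun_expect_prod (F : I -> T -> R) :
  \sum_(t : {ffun I -> T}) (\prod_i P i (t i)) * (\prod_i F i (t i)) =
  \prod_i \sum_x P i x * F i x.
Proof.
rewrite bigA_distr_bigA /=.
by apply: eq_bigr => t _; rewrite big_split.
Qed.

Lemma ffun_mass : \sum_(t : {ffun I -> T}) \prod_i P i (t i) = 1.
Proof. by rewrite -bigA_distr_bigA /= big1. Qed.

Lemma ffun_expect1 (i : I) (f : T -> R) :
  \sum_(t : {ffun I -> T}) (\prod_k P k (t k)) * f (t i) =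
  \sum_x P i x * f x.
Proof.
transitivity (\sum_(t : {ffun I -> T}) (\prod_k P k (t k)) *
    \prod_k (if k == i then f (t k) else 1)).
  by apply: eq_bigr => t _; rewrite -big_mkcond big_pred1_eq.
rewrite (ffun_expect_prod (fun k x => if k == i then f x else 1)).
rewrite (bigD1 i) //= eqxx [X in _ * X]big1 ?mulr1 // => k /negbTE ->.
by rewrite -[RHS](P1 k); apply: eq_bigr => x _; rewrite mulr1.
Qed.

Lemma ffun_expect2 (i j : I) (f g : T -> R) : i != j ->
  \sum_(t : {ffun I -> T}) (\prod_k P k (t k)) * (f (t i) * g (t j)) =
  (\sum_x P i x * f x) * (\sum_x P j x * g x).
Proof.
move=> ij; have ji : (j == i) = false by rewrite eq_sym; apply/negbTE.
pose F k x := (if k == i then f x else 1) * (if k == j then g x else 1).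
transitivity (\sum_(t : {ffun I -> T}) (\prod_k P k (t k)) *
    \prod_k F k (t k)).
  apply: eq_bigr => t _.
  by rewrite big_split /= -!big_mkcond !big_pred1_eq.
rewrite (ffun_expect_prod F) (bigD1 i) //= (bigD1 j) ?ji //=.
rewrite [X in _ * (_ * X)]big1 => [|k /andP[/negbTE ki /negbTE kj]].
  rewrite mulr1 /F !eqxx (negbTE ij) ji.
  by congr (_ * _); apply: eq_bigr => x _; rewrite ?mulr1 ?mul1r.
by rewrite -[RHS](P1 k); apply: eq_bigr => x _; rewrite /F ki kj !mulr1.
Qed.

(** Cross terms factor into products of two means, which vanish by centering, so only the diagonal
    survives. *)
Lemma ffun_variance (f : I -> T -> R) :
  (forall i, \sum_x P i x * f i x = 0) ->
  \sum_(t : {ffun I -> T}) (\prod_k P k (t k)) * (\sum_i f i (t i)) ^+ 2 =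
  \sum_i \sum_x P i x * f i x ^+ 2.
Proof.
move=> f0.
transitivity (\sum_i \sum_(t : {ffun I -> T}) \sum_j
    (\prod_k P k (t k)) * (f i (t i) * f j (t j))).
  rewrite exchange_big; apply: eq_bigr => t _.
  by rewrite expr2 big_distrlr mulr_sumr; apply: eq_bigr => i _; rewrite mulr_sumr.
apply: eq_bigr => i _; rewrite exchange_big (bigD1 i) //= [X in _ + X]big1 ?addr0.
  rewrite -(ffun_expect1 i (fun x => f i x ^+ 2)).
  by apply: eq_bigr => t _; rewrite expr2.
by move=> j ji; rewrite ffun_expect2 1?eq_sym // f0 mul0r.
Qed.

End ProductExpectation.

(** * Gibbs' inequality and binary entropy *)

Section Entropy.
Context {R : realType}.
Implicit Types p : R.

(** Comes from [ln t <= t - 1] at [t = y / x]. The implication rules out [y = 0 < x], where the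
    conventions [x / 0 = 0] and [ln 0 = 0] would make the right side 0. *)
Lemma mulr_ln_ge (x y : R) : 0 <= x -> 0 <= y -> (y = 0 -> x = 0) ->
  x - y <= x * ln (x / y).
Proof.
move=> x0 y0 yx; have [->|xn0] := eqVneq x 0.
  by rewrite !mul0r sub0r oppr_le0.
have xp : 0 < x by rewrite lt_def xn0.
have yp : 0 < y.
  by rewrite lt_def y0 andbT; apply/eqP => /yx/eqP; rewrite (negbTE xn0).
have h : ln (y / x) <= y / x - 1.
  have := @le_ln1Dx R (y / x - 1).
  by rewrite addrCA subrr addr0; apply; rewrite ltrBrDl subrr divr_gt0.
rewrite -[x / y]invf_div lnV ?posrE ?divr_gt0 // mulrN lerNr opprB.
rewrite (le_trans (ler_wpM2l x0 h)) // mulrBr mulr1 mulrCA divff // mulr1 //.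
Qed.

(** The sum is the divergence of [P] from the uniform law; termwise, [mulr_ln_ge] bounds it below by
    the difference of the two total masses, which is 0. *)
Lemma gibbs_uniform (T : finType) (P : T -> R) :
  (forall x, 0 <= P x) -> \sum_x P x = 1 ->
  0 <= \sum_x P x * ln (#|T|%:R * P x).
Proof.
move=> P0 P1; have T0 : 0 < #|T|%:R :> R.
  rewrite ltr0n lt0n; apply/eqP => /card0_eq T0; move/eqP: P1.
  by rewrite big1 ?(eq_sym 0) ?oner_eq0 // => x; move: (T0 x).
apply: (@le_trans _ _ (\sum_x (P x - #|T|%:R^-1))).
  by rewrite big_split /= P1 sumr_const mulNrn -[X in _ - X]mulr_natl divff ?gt_eqF //.
apply: ler_sum => x _.
have := @mulr_ln_ge (P x) #|T|%:R^-1; rewrite invrK (mulrC #|T|%:R).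
apply=> //;
by move/eqP; rewrite invr_eq0 gt_eqF.
Qed.

Lemma bscC p b y : bsc p b y = bsc p y b.
Proof. by rewrite /bsc eq_sym. Qed.

Lemma bsc_ge0 p b y : 0 <= p <= 1 -> 0 <= bsc p b y.
Proof. by move=> /andP[p0 p1]; rewrite /bsc; case: ifP => _; lra. Qed.

Lemma sum_bsc p b : \sum_y bsc p b y = 1.
Proof. by rewrite big_bool /bsc; case: b => /=; ring. Qed.

Lemma ln2_gt0 : 0 < ln (2 : R).
Proof. by rewrite ln_gt0 // ltr1n. Qed.

Lemma Hb_ln2 p : Hb p * ln 2 = - p * ln p - (1 - p) * ln (1 - p).
Proof. by rewrite /Hb /log2; field; rewrite gt_eqF // ln2_gt0. Qed.

Lemma sum_bsc_ln p b : \sum_y bsc p b y * ln (bsc p b y) = - (Hb p * ln 2).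
Proof. by rewrite Hb_ln2 big_bool /bsc; case: b => /=; ring. Qed.

(** Gibbs' inequality for the two-point output law of the channel, whose divergence from uniform is
    [ln 2 - Hb p * ln 2]. *)
Lemma Hb_le1 p : 0 <= p <= 1 -> Hb p <= 1.
Proof.
move=> p01; have l2 := ln2_gt0.
rewrite -(ler_pM2r l2) mul1r -subr_ge0.
have := @gibbs_uniform _ (bsc p true) (fun y => bsc_ge0 true y p01) (sum_bsc p true).
congr (0 <= _); rewrite card_bool.
transitivity (\sum_y (bsc p true y * ln 2 + bsc p true y * ln (bsc p true y))).
  apply: eq_bigr => y _; have [->|n0] := eqVneq (bsc p true y) 0.
    by rewrite !mul0r addr0.
  by rewrite lnM ?mulrDr // posrE ?ltr0n // lt_def n0 bsc_ge0.
by rewrite big_split /= sum_bsc_ln -mulr_suml sum_bsc mul1r.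
Qed.

End Entropy.

(** * The block-fading channel *)

Section BlockFading.
Context {R : realType}.
Variables (a b q : R).
Hypotheses (a01 : 0 <= a <= 1) (b01 : 0 <= b <= 1) (q01 : 0 <= q <= 1).

Lemma state_prob_ge0 B (s : states B) : 0 <= state_prob q s.
Proof.
by case/andP: q01 => q0 q1; apply: prodr_ge0 => k _; case: ifP; lra.
Qed.

Lemma sum_state_prob B : \sum_(s : states B) state_prob q s = 1.
Proof.
apply: (ffun_mass (P := fun _ t => if t then q else 1 - q)) => _.
by rewrite big_bool /=; ring.
Qed.

Lemma block_bsc_ge0 N B (s : states B) (x y : word N B) :
  0 <= block_bsc a b s x y.
Proof. by apply: prodr_ge0 => i _; apply: bsc_ge0; case: ifP. Qed.

Lemma block_bscC N B (s : states B) (x y : word N B) :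
  block_bsc a b s x y = block_bsc a b s y x.
Proof. by apply: eq_bigr => i _; rewrite bscC. Qed.

Lemma sum_block_bsc N B (s : states B) (x : word N B) :
  \sum_y block_bsc a b s x y = 1.
Proof.
apply: (ffun_mass (P := fun i => bsc (if s i.1 then a else b) (x i))) => i.
exact: sum_bsc.
Qed.

Lemma sum_block_bsc_input N B (s : states B) (y : word N B) :
  \sum_x block_bsc a b s x y = 1.
Proof.
by rewrite -[RHS](sum_block_bsc s y); apply: eq_bigr => x _; rewrite block_bscC.
Qed.

Definition loglik N B (s : states B) (x y : word N B) : R :=
  \sum_i ln (bsc (if s i.1 then a else b) (x i) (y i)).

Lemma expR_loglik N B (s : states B) (x y : word N B) :
  expR (loglik s x y) =
  \prod_i expR (ln (bsc (if s i.1 then a else b) (x i) (y i))).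
Proof. exact: (big_morph _ (@expRD R) (@expR0 R)). Qed.

(* Only an inequality in general, because [ln 0 = 0]. *)
Lemma block_bsc_le_loglik N B (s : states B) (x y : word N B) :
  block_bsc a b s x y <= expR (loglik s x y).
Proof.
rewrite expR_loglik; apply: ler_prod => i _.
set p := bsc _ _ _; have p0 : 0 <= p by apply: bsc_ge0; case: ifP.
rewrite p0 /=; move: p0; rewrite le_eqVlt => /predU1P[<-|p0].
  exact: expR_ge0.
by rewrite lnK.
Qed.

Lemma block_bsc_loglik N B (s : states B) (x y : word N B) :
  0 < block_bsc a b s x y -> block_bsc a b s x y = expR (loglik s x y).
Proof.
move=> W0; rewrite expR_loglik; apply: eq_bigr => i _; rewrite lnK // posrE.
rewrite lt_def bsc_ge0 ?andbT; last by case: ifP.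
apply: contraTneq W0 => p0; rewrite -leNgt /block_bsc (bigD1 i) //= p0.
by rewrite mul0r.
Qed.

(** The conditional entropy [H(Y|X,S)] per symbol, in nats. *)
Definition mean_entropy : R := (q * Hb a + (1 - q) * Hb b) * ln 2.

Lemma mean_entropy_le : mean_entropy <= ln 2.
Proof.
rewrite /mean_entropy -[leRHS]mul1r ler_wpM2r ?(ltW ln2_gt0) //.
have := Hb_le1 a01; have := Hb_le1 b01; case/andP: q01; nra.
Qed.

(* Given the states the deviation has mean [n h - N sum_k h(s_k)], so it is
   split into a noise part and a state part, both sums of centered terms. *)
Lemma loglik_moment : exists V : R, forall N B (x : word N B),
  \sum_(s : states B) state_prob q s *
    \sum_y block_bsc a b s x y *
      (loglik s x y + (N * B)%:R * mean_entropy) ^+ 2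
  <= V * (N * N * B)%:R.
Proof.
pose par (t : bool) := if t then a else b.
pose e p : R := Hb p * ln 2.
pose v p c : R := \sum_y bsc p c y * (ln (bsc p c y) + e p) ^+ 2.
have vC p c : v p c = v p true.
  by rewrite /v !big_bool /bsc; case: c => //=; rewrite addrC.
have v0 p : 0 <= p <= 1 -> 0 <= v p true.
  by move=> p01; apply: sumr_ge0 => y _; rewrite mulr_ge0 ?sqr_ge0 ?bsc_ge0.
pose g t := mean_entropy - e (par t).
pose pq (t : bool) := if t then q else 1 - q.
pose V1 := v a true + v b true.
pose V2 := \sum_t pq t * g t ^+ 2.
have V1_ge0 : 0 <= V1 by rewrite addr_ge0 ?v0.
exists (2 * V1 + 2 * V2) => N B x.
pose f (s : states B) i y := ln (bsc (par (s i.1)) (x i) y) + e (par (s i.1)).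
have dec s y : loglik s x y + (N * B)%:R * mean_entropy =
    \sum_i f s i (y i) + N%:R * \sum_k g (s k).
  (* The state is constant over a block, so its deviation counts [N] times; hence the order
     [N * N * B] of the second moment. *)
  have -> : N%:R * \sum_k g (s k) = \sum_(i : 'I_B * 'I_N) g (s i.1).
    rewrite -(pair_bigA _ (fun k _ => g (s k))) /= mulr_sumr.
    by apply: eq_bigr => k _; rewrite sumr_const card_ord mulr_natl.
  rewrite -big_split /=.
  transitivity (loglik s x y + \sum_(i : 'I_B * 'I_N) mean_entropy).
    by rewrite sumr_const card_prod !card_ord mulr_natl mulnC.
  by rewrite -big_split; apply: eq_bigr => i _; rewrite /f /g /par /=; ring.
have noise s : \sum_y block_bsc a b s x y * (\sum_i f s i (y i)) ^+ 2
    <= (N * B)%:R * V1.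
  rewrite (ffun_variance (P := fun i => bsc (par (s i.1)) (x i))); first last.
  - move=> i; under eq_bigr do rewrite mulrDr.
    by rewrite big_split /= sum_bsc_ln -mulr_suml sum_bsc mul1r addNr.
  - by move=> i; exact: sum_bsc.
  apply: (@le_trans _ _ (\sum_(i : 'I_B * 'I_N) V1)).
    apply: ler_sum => i _; rewrite -/(v _ _) vC /V1 /par.
    by case: ifP => _; rewrite ?lerDl ?lerDr v0.
  by rewrite sumr_const card_prod !card_ord mulr_natl mulnC.
have state : \sum_(s : states B) state_prob q s * (\sum_k g (s k)) ^+ 2
    = B%:R * V2.
  rewrite (@ffun_variance _ _ _ (fun _ => pq) _ (fun _ => g)).
  - by rewrite sumr_const card_ord mulr_natl.
  - by move=> _; rewrite big_bool /pq /=; ring.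
  - by move=> _; rewrite big_bool /pq /g /par /mean_entropy /e /=; ring.
apply: (@le_trans _ _ (\sum_(s : states B) state_prob q s *
    (2 * ((N * B)%:R * V1) + 2 * (N%:R * \sum_k g (s k)) ^+ 2))).
  apply: ler_sum => s _; apply: ler_wpM2l; first exact: state_prob_ge0.
  set G := N%:R * _.
  apply: (@le_trans _ _ (\sum_y block_bsc a b s x y *
      (2 * (\sum_i f s i (y i)) ^+ 2 + 2 * G ^+ 2))).
    apply: ler_sum => y _; apply: ler_wpM2l; first exact: block_bsc_ge0.
    (* [(F + G)^2 <= 2 F^2 + 2 G^2] separates noise from states without evaluating a cross term. *)
    rewrite dec -/G; set F := \sum_i _; rewrite -subr_ge0.
    by rewrite (_ : _ - _ = (F - G) ^+ 2) ?sqr_ge0 //; ring.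
  under eq_bigr do rewrite mulrDr (mulrCA _ 2).
  by rewrite big_split /= -mulr_sumr -mulr_suml sum_block_bsc mul1r lerD2r
     ler_pM2l.
under eq_bigr do
  rewrite mulrDr exprMn (mulrA 2 (N%:R ^+ 2)) [X in _ + X]mulrCA.
rewrite big_split /= -mulr_suml sum_state_prob mul1r -!mulr_sumr state.
have hN : (N * B)%:R <= (N * N * B)%:R :> R.
  by rewrite ler_nat; case: (N) => // n; rewrite leq_mul2r leq_pmulr ?orbT.
rewrite [leRHS]mulrDl; apply: lerD.
  by rewrite -mulrA ler_pM2l // mulrC ler_wpM2l.
by rewrite !natrM; lra.
Qed.

End BlockFading.

(** * Random codebooks *)

Section RandomCodebook.
Context {R : realType} {X : finType}.
Variables (K L : nat).
Hypothesis X_gt0 : (0 < #|X|)%N.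

Definition codebook := {ffun 'I_K.+1 * 'I_L.+1 -> X}.

Local Notation M := (#|X|%:R : R).

(** The uniform weight is written as a product over the entries, so that the expectations under
    product laws apply. *)
Definition codebook_mean (F : codebook -> R) : R :=
  \sum_c (\prod_(a : 'I_K.+1 * 'I_L.+1) M^-1) * F c.

Let M_gt0 : 0 < M. Proof. by rewrite ltr0n. Qed.

Let Mneq0 : M != 0. Proof. by rewrite gt_eqF. Qed.

Lemma sum_uniform : \sum_(x : X) M^-1 = 1.
Proof. by rewrite sumr_const -[LHS]mulr_natl divff. Qed.

Lemma codebook_mean1 a f :
  codebook_mean (fun c => f (c a)) = \sum_x M^-1 * f x.
Proof. exact: (ffun_expect1 (P := fun _ _ => M^-1) (fun _ => sum_uniform)). Qed.

Lemma codebook_mean2 a b f g : a != b ->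
  codebook_mean (fun c => f (c a) * g (c b)) =
  (\sum_x M^-1 * f x) * (\sum_x M^-1 * g x).
Proof. exact: (ffun_expect2 (P := fun _ _ => M^-1) (fun _ => sum_uniform)). Qed.

Lemma codebook_mean_cst k : codebook_mean (fun=> k) = k.
Proof.
rewrite /codebook_mean -mulr_suml.
by rewrite (ffun_mass (P := fun _ _ => M^-1) (fun _ => sum_uniform)) mul1r.
Qed.

Lemma codebook_meanD F G :
  codebook_mean (fun c => F c + G c) = codebook_mean F + codebook_mean G.
Proof.
by rewrite /codebook_mean -big_split; apply: eq_bigr => c _; rewrite mulrDr.
Qed.

Lemma codebook_meanZ k F :
  codebook_mean (fun c => k * F c) = k * codebook_mean F.
Proof. by rewrite /codebook_mean mulr_sumr; apply: eq_bigr => c _; ring. Qed.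

Lemma codebook_mean_sum (I : finType) (P : pred I) (F : I -> codebook -> R) :
  codebook_mean (fun c => \sum_(i | P i) F i c) =
  \sum_(i | P i) codebook_mean (F i).
Proof.
rewrite /codebook_mean exchange_big; apply: eq_bigr => c _.
by rewrite mulr_sumr.
Qed.

Lemma codebook_mean_le F G : (forall c, F c <= G c) ->
  codebook_mean F <= codebook_mean G.
Proof.
move=> FG; apply: ler_sum => c _; apply: ler_wpM2l => //.
by apply: prodr_ge0 => _ _; rewrite invr_ge0 ltW.
Qed.

Lemma codebook_mean_exists F k : codebook_mean F <= k -> exists c, F c <= k.
Proof.
move=> Fk; apply: contrapT => /forallNP noc.
have /card_gt0P[x0 _] := X_gt0.
have gt c : k < F c by rewrite ltNge; apply/negP.
move: Fk; apply/negP; rewrite -ltNge -{1}(codebook_mean_cst k).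
apply: ltr_sum => [|c _]; last first.
  by rewrite ltr_pM2l // prodr_gt0 // => _ _; rewrite invr_gt0.
by apply/hasP; exists [ffun=> x0] => //; rewrite mem_index_enum.
Qed.

(** With [w = W(z|.)] this is the probability of output [z] given message [m]; with [w] a point mass
    it is the encoder. *)
Definition bin_law (w : X -> R) (c : codebook) (m : 'I_K.+1) : R :=
  \sum_(u < L.+1) L.+1%:R^-1 * w (c (m, u)).

(* Conditionally on the codeword [c (m, u)], the law [bin_law w c m] has mean
   at most [w (c (m, u)) / L + 1 / M]; [ln t <= ln A + t / A - 1], the tangent
   of [ln] at [A], replaces conditional Jensen. *)
Lemma codebook_mean_bin_ln (w : X -> R) m u :
  (forall x, 0 <= w x) -> \sum_x w x = 1 ->
  codebook_mean (fun c => w (c (m, u)) * ln (M * bin_law w c m)) <=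
  \sum_x M^-1 * (w x * ln (1 + M * (L.+1%:R^-1 * w x))).
Proof.
move=> w0 w1; pose l : R := L.+1%:R^-1.
have l0 : 0 < l by rewrite invr_gt0 ltr0n.
pose A x := 1 + M * (l * w x).
have A_gt0 x : 0 < A x by rewrite ltr_wpDr // !mulr_ge0 // ltW.
pose r x := w x / A x.
have r0 x : 0 <= r x by rewrite divr_ge0 // ltW.
apply: (@le_trans _ _ (codebook_mean (fun c => w (c (m, u)) * ln (A (c (m, u)))
   + (\sum_(v | v != u) (M * l) * (r (c (m, u)) * w (c (m, v)))
      + - 1 * r (c (m, u)))))).
  apply: codebook_mean_le => c; rewrite /bin_law (bigD1 u) //= -/l.
  set x := c (m, u); set S := \sum_(v | v != u) _.
  have S0 : 0 <= S by apply: sumr_ge0 => v _; rewrite mulr_ge0 // ltW.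
  have -> : \sum_(v | v != u) (M * l) * (r x * w (c (m, v))) = r x * (M * S).
    rewrite /S !mulr_sumr; apply: eq_bigr => v _; ring.
  have [wx0|wn0] := eqVneq (w x) 0.
    by rewrite /r wx0 !mul0r mulr0 addr0.
  have wp : 0 < w x by rewrite lt_def wn0 w0.
  have t0 : 0 < M * (l * w x + S) by rewrite mulr_gt0 // ltr_pwDl // mulr_gt0.
  have h : ln (M * (l * w x + S)) <= ln (A x) + (M * (l * w x + S) / A x - 1).
    rewrite -lerBlDl -ln_div ?posrE //.
    have := @le_ln1Dx R (M * (l * w x + S) / A x - 1).
    rewrite addrCA subrr addr0; apply.
    by rewrite ltrBrDl subrr divr_gt0.
  apply: (le_trans (ler_wpM2l (w0 x) h)); rewrite le_eqVlt; apply/orP; left.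
  by apply/eqP; rewrite /r /A; field; rewrite gt_eqF // A_gt0.
(* It remains to see that the linear correction of the tangent has nonpositive mean. *)
rewrite codebook_meanD (codebook_mean1 _ (fun x => w x * ln (A x))) gerDl.
rewrite codebook_meanD codebook_mean_sum codebook_meanZ codebook_mean1.
set Q := \sum_x M^-1 * r x.
(* Distinct entries are independent and [w] has mass 1, so each of the [L] other words of the bin
   contributes [Q / (L + 1)]; together they stay below [Q]. *)
have pair v : v != u ->
    codebook_mean (fun c => (M * l) * (r (c (m, u)) * w (c (m, v)))) = l * Q.
  move=> vu; rewrite codebook_meanZ codebook_mean2; last first.
    by apply: contraNneq vu => -[->].
  by rewrite -[X in _ * (_ * X)]mulr_sumr w1 -/Q; field; exact: Mneq0.
rewrite (eq_bigr _ pair) sumr_const mulN1r subr_le0.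
have Q0 : 0 <= Q.
  by apply: sumr_ge0 => x _; rewrite mulr_ge0 // invr_ge0 ltW.
rewrite -mulrnAl -[leRHS]mul1r ler_wpM2r //.
rewrite cardC1 card_ord /= -mulr_natl ler_pdivrMr ?ltr0n // mul1r ler_nat.
exact: leqnSn.
Qed.

End RandomCodebook.

(** * Leakage *)

Section Leakage.
Context {R : realType}.
Variables (a b q q' : R).
Hypotheses (a01 : 0 <= a <= 1) (b01 : 0 <= b <= 1).
Hypotheses (q01 : 0 <= q <= 1) (q'01 : 0 <= q' <= 1).

Lemma card_word N B : #|word N B|%:R = expR ((N * B)%:R * ln 2) :> R.
Proof.
rewrite card_ffun card_bool card_prod !card_ord mulnC natrX.
by rewrite mulrC expRM_natr lnK // posrE.
Qed.

Lemma card_word_gt0 N B : (0 < #|word N B|)%N.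
Proof. by rewrite card_ffun card_bool expn_gt0. Qed.

Lemma sum_states_fst B (F : states B -> R) :
  \sum_(s : states B * states B) state_prob q s.1 * state_prob q' s.2 * F s.1
  = \sum_s state_prob q s * F s.
Proof.
rewrite -(pair_bigA _ (fun s t => state_prob q s * state_prob q' t * F s)) /=.
apply: eq_bigr => s _; under eq_bigr do rewrite mulrAC.
by rewrite -mulr_sumr sum_state_prob mulr1.
Qed.

Lemma sum_states_snd B (F : states B -> R) :
  \sum_(s : states B * states B) state_prob q s.1 * state_prob q' s.2 * F s.2
  = \sum_s state_prob q' s * F s.
Proof.
rewrite -(pair_bigA _ (fun s t => state_prob q s * state_prob q' t * F t)) /=.
rewrite exchange_big; apply: eq_bigr => t _; under eq_bigr do rewrite -mulrA.
by rewrite -mulr_suml sum_state_prob mul1r.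
Qed.

Definition eve_law N B K (enc : 'I_K -> word N B -> R) m s z : R :=
  \sum_x enc m x * block_bsc a b s x z.

(** The conditional divergence of [P(Z|M,S)] from the uniform law, in nats. *)
Definition eve_divergence N B K (enc : 'I_K -> word N B -> R) : R :=
  \sum_m K%:R^-1 * \sum_s state_prob q' s *
    \sum_z eve_law enc m s z * ln (#|word N B|%:R * eve_law enc m s z).

Section Encoder.
Variables (N B K : nat) (enc : 'I_K.+1 -> word N B -> R).
Hypothesis enc_ok : is_encoder enc.

Lemma eve_law_ge0 m s z : 0 <= eve_law enc m s z.
Proof.
apply: sumr_ge0 => x _; rewrite mulr_ge0 ?block_bsc_ge0 //.
by case: (enc_ok m).
Qed.

Lemma sum_eve_law m s : \sum_z eve_law enc m s z = 1.
Proof.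
rewrite exchange_big -[RHS](enc_ok m).2; apply: eq_bigr => x _.
by rewrite -mulr_sumr sum_block_bsc mulr1.
Qed.

Lemma eve_divergence_ge0 : 0 <= eve_divergence enc.
Proof.
apply: sumr_ge0 => m _; rewrite mulr_ge0 ?invr_ge0 //.
apply: sumr_ge0 => s _; rewrite mulr_ge0 ?state_prob_ge0 //.
apply: gibbs_uniform => [z|]; [exact: eve_law_ge0|exact: sum_eve_law].
Qed.

(* I(M;Z|S) is this divergence from the uniform law, minus the divergence of
   the law of Z from it. *)
Lemma leakage_le_divergence :
  leakage a b q q' enc * ln 2 <= eve_divergence enc.
Proof.
pose k : R := K.+1%:R^-1; pose pi (s : states B * states B) :=
  state_prob q s.1 * state_prob q' s.2.
pose p m s z := eve_law enc m s z.
pose pb s z := \sum_m k * p m s z.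
have k0 : 0 < k by rewrite invr_gt0 ltr0n.
have sumk : \sum_(m < K.+1) k = 1.
  by rewrite sumr_const card_ord -[LHS]mulr_natl divff // pnatr_eq0.
have p0 m s z : 0 <= p m s z by exact: eve_law_ge0.
have p1 m s : \sum_z p m s z = 1 by exact: sum_eve_law.
have pb0 s z : 0 <= pb s z.
  by apply: sumr_ge0 => m _; rewrite mulr_ge0 // ltW.
have pb1 s : \sum_z pb s z = 1.
  rewrite exchange_big -[RHS]sumk; apply: eq_bigr => m _.
  by rewrite -mulr_sumr p1 mulr1.
have pi0 s : 0 <= pi s by rewrite mulr_ge0 ?state_prob_ge0.
have PE m z s : MZS_pmf a b q q' enc m z s = pi s * (k * p m s.2 z).
  by rewrite /MZS_pmf /pi /k /p /eve_law; ring.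
have Mp : 0 < #|word N B|%:R :> R by rewrite ltr0n card_word_gt0.
pose M : R := #|word N B|%:R.
have sumz m s : \sum_z MZS_pmf a b q q' enc m z s = pi s * k.
  by under eq_bigr do rewrite PE; rewrite -!mulr_sumr p1 mulr1.
have summ z s : \sum_m MZS_pmf a b q q' enc m z s = pi s * pb s.2 z.
  by under eq_bigr do rewrite PE; rewrite -mulr_sumr.
have summz s : \sum_m \sum_z MZS_pmf a b q q' enc m z s = pi s.
  by under eq_bigr do rewrite sumz; rewrite -mulr_sumr sumk mulr1.
(* The logarithm of the ratio is split through the uniform law. This needs positive arguments; where
   the state or output probability is 0, both sides vanish. *)
have term m z s : MZS_pmf a b q q' enc m z s * log2 (MZS_pmf a b q q' enc m z s *
     (\sum_m' \sum_z' MZS_pmf a b q q' enc m' z' s) /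
     ((\sum_z' MZS_pmf a b q q' enc m z' s) *
      (\sum_m' MZS_pmf a b q q' enc m' z s))) * ln 2 =
   pi s * (k * (p m s.2 z * ln (M * p m s.2 z)))
   - pi s * (k * p m s.2 z * ln (M * pb s.2 z)).
  rewrite summz sumz summ PE; have l2 := gt_eqF (@ln2_gt0 R).
  have [pis|pis] := eqVneq (pi s) 0; first by rewrite pis !mul0r subrr.
  have [ps|ps] := eqVneq (p m s.2 z) 0.
    by rewrite ps !(mul0r, mulr0) subrr.
  have pp : 0 < p m s.2 z by rewrite lt_def ps p0.
  have pbp : 0 < pb s.2 z.
    apply: (@lt_le_trans _ _ (k * p m s.2 z)); first by rewrite mulr_gt0.
    rewrite /pb (bigD1 m) //= lerDl; apply: sumr_ge0 => j _.
    by rewrite mulr_ge0 // ltW.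
  have -> : pi s * (k * p m s.2 z) * pi s / (pi s * k * (pi s * pb s.2 z)) =
      M * p m s.2 z / (M * pb s.2 z).
    by field; rewrite pis !gt_eqF.
  rewrite /log2 ln_div ?posrE ?mulr_gt0 //.
  by field; rewrite l2.
rewrite /leakage /cond_mutual_info mulr_suml.
under eq_bigr => m _.
  rewrite mulr_suml.
  under eq_bigr => z _.
    rewrite mulr_suml; under eq_bigr do rewrite term.
    rewrite sumrB; over.
  rewrite sumrB; over.
rewrite sumrB -[leRHS]subr0; apply: lerB.
  rewrite le_eqVlt; apply/orP; left; apply/eqP; apply: eq_bigr => m _.
  rewrite -/k -sum_states_snd mulr_sumr exchange_big; apply: eq_bigr => s _.
  by rewrite -mulr_sumr -mulr_sumr mulrCA.
rewrite exchange_big; under eq_bigr do rewrite exchange_big.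
rewrite exchange_big; apply: sumr_ge0 => s _.
under eq_bigr do rewrite -mulr_sumr -mulr_suml.
rewrite -mulr_sumr mulr_ge0 //; exact: gibbs_uniform (pb0 s.2) (pb1 s.2).
Qed.

End Encoder.
End Leakage.

(** * Random binning *)

Section RandomBinning.
Context {R : realType}.
Variables (a b q : R).
Hypotheses (a01 : 0 <= a <= 1) (b01 : 0 <= b <= 1) (q01 : 0 <= q <= 1).
Variables (N B K L : nat).

Local Notation code := (@codebook (word N B) K L).
Local Notation W := (block_bsc a b).
Local Notation M := (#|word N B|%:R : R).
Local Notation h := ((N * B)%:R * mean_entropy a b q).

(** The index in the bin is uniform, so a word repeated in the bin counts with multiplicity. *)
Definition bin_encoder (c : code) (m : 'I_K.+1) (x : word N B) : R :=
  bin_law (fun x' => (x' == x)%:R) c m.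

Lemma sum_bin_encoder (c : code) m (G : word N B -> R) :
  \sum_x bin_encoder c m x * G x = bin_law G c m.
Proof.
under eq_bigr do rewrite mulr_suml.
rewrite exchange_big; apply: eq_bigr => u _.
rewrite (bigD1 (c (m, u))) //= eqxx mulr1 big1 ?addr0 // => x.
by rewrite eq_sym => /negbTE->; rewrite mulr0 mul0r.
Qed.

Lemma bin_encoder_ok (c : code) : is_encoder (bin_encoder c).
Proof.
move=> m; split=> [x|]; first by apply: sumr_ge0 => u _; rewrite mulr_ge0.
transitivity (\sum_x bin_encoder c m x * 1).
  by apply: eq_bigr => x _; rewrite mulr1.
rewrite sum_bin_encoder /bin_law -mulr_suml mulr1 sumr_const card_ord.
by rewrite -[LHS]mulr_natl divff // pnatr_eq0.
Qed.

Variables (v tau : R).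
Hypothesis tau_gt0 : 0 < tau.
Hypothesis moment : forall x : word N B,
  \sum_s state_prob q s * \sum_y W s x y * (loglik a b s x y + h) ^+ 2 <= v.

Let M_gt0 : 0 < M. Proof. by rewrite ltr0n card_word_gt0. Qed.

Lemma mean_moment : \sum_(x : word N B) M^-1 *
  (\sum_s state_prob q s * \sum_y W s x y * (loglik a b s x y + h) ^+ 2) <= v.
Proof.
apply: (@le_trans _ _ (\sum_(x : word N B) M^-1 * v)).
  by apply: ler_sum => x _; rewrite ler_wpM2l // invr_ge0 ltW.
by rewrite -mulr_suml sum_uniform ?card_word_gt0 // mul1r.
Qed.

(** [M W / (L + 1)] is at most [exp (D - tau)], with [D] the deviation of the log-likelihood, and
    [D - tau <= D^2 / (4 tau)]. This holds for typical and atypical outputs alike, so the second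
    moment suffices. *)
Lemma ln_bin_le s (x z : word N B) :
  expR ((N * B)%:R * ln 2 - h + tau) <= L.+1%:R ->
  ln (1 + M * (L.+1%:R^-1 * W s x z)) <=
  1 + (loglik a b s x z + h) ^+ 2 / (4 * tau).
Proof.
move=> hL; set D := loglik _ _ _ _ _ + h; set w := D ^+ 2 / (4 * tau).
have w0 : 0 <= w by rewrite divr_ge0 ?sqr_ge0 // mulr_ge0 // ltW.
have wD : D - tau <= w.
  by rewrite /w ler_pdivlMr ?mulr_gt0 // -subr_ge0
    (_ : _ - _ = (D - 2 * tau) ^+ 2) ?sqr_ge0 //; ring.
have L0 : 0 < L.+1%:R :> R by rewrite ltr0n.
have W0 : 0 <= W s x z by exact: block_bsc_ge0.
rewrite -[leRHS]expRK ler_ln ?posrE ?expR_gt0 //; last first.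
  by rewrite ltr_wpDr // mulr_ge0 ?(ltW M_gt0) // mulr_ge0 ?invr_ge0.
have MW : M * (L.+1%:R^-1 * W s x z) <= expR w.
  rewrite mulrCA mulrC ler_pdivrMr // card_word.
  apply: (@le_trans _ _ (expR ((N * B)%:R * ln 2) * expR (loglik a b s x z))).
    by rewrite ler_pM2l ?expR_gt0 // block_bsc_le_loglik.
  apply: (@le_trans _ _ (expR w * expR ((N * B)%:R * ln 2 - h + tau))).
    by rewrite -!expRD ler_expR; move: wD; rewrite /D; lra.
  by rewrite ler_pM2l // expR_gt0.
have e2 : 2 <= expR 1 :> R by have := @expR_ge1Dx R 1; lra.
have ew : 1 <= expR w by rewrite -expR0 ler_expR.
rewrite expRD; apply: (@le_trans _ _ (2 * expR w)); first
  by move: MW ew; set u := M * _; set e := expR w; lra.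
by rewrite ler_wpM2r // expR_ge0.
Qed.

(** For each message, output [z] and index in the bin, [codebook_mean_bin_ln] applies with
    [w = W(z|.)]; [ln_bin_le] then reduces the mean to the second moment. *)
Lemma mean_divergence_le :
  expR ((N * B)%:R * ln 2 - h + tau) <= L.+1%:R ->
  codebook_mean (fun c : code => eve_divergence a b q (bin_encoder c))
  <= 1 + v / (4 * tau).
Proof.
move=> hL; pose D s (x z : word N B) := (loglik a b s x z + h) ^+ 2.
pose l : R := L.+1%:R^-1.
have l0 : 0 <= l by rewrite invr_ge0.
pose U : R := \sum_(x : word N B) M^-1 *
  \sum_s state_prob q s * \sum_z W s x z * (1 + D s x z / (4 * tau)).
apply: (@le_trans _ _ U); last first.
  rewrite /U; under eq_bigr => x _.
    under eq_bigr => s _.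
      under eq_bigr do rewrite mulrDr mulr1 mulrA.
      rewrite big_split /= sum_block_bsc -mulr_suml mulrDr mulr1 mulrA; over.
    rewrite big_split /= sum_state_prob -mulr_suml mulrDr mulr1 mulrA; over.
  rewrite big_split /= sum_uniform ?card_word_gt0 // lerD2l -mulr_suml.
  by rewrite ler_wpM2r ?mean_moment // invr_ge0 mulr_ge0 // ltW.
have -> : U = \sum_(m < K.+1) K.+1%:R^-1 * U.
  by rewrite sumr_const card_ord -[RHS]mulr_natl mulrA divff ?mul1r // pnatr_eq0.
rewrite codebook_mean_sum; apply: ler_sum => m _.
rewrite codebook_meanZ ler_wpM2l ?invr_ge0 // codebook_mean_sum /U.
under [leRHS]eq_bigr do rewrite mulr_sumr.
rewrite [leRHS]exchange_big; apply: ler_sum => s _; rewrite codebook_meanZ.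
under [leRHS]eq_bigr do rewrite mulrCA.
rewrite -mulr_sumr ler_wpM2l ?state_prob_ge0 // codebook_mean_sum.
under [leRHS]eq_bigr do rewrite mulr_sumr.
rewrite [leRHS]exchange_big; apply: ler_sum => z _.
set G := leRHS.
have -> : G = \sum_(u < L.+1) l * G.
  by rewrite sumr_const card_ord -[RHS]mulr_natl mulrA divff ?mul1r // pnatr_eq0.
pose w x := W s x z.
apply: (@le_trans _ _ (codebook_mean (fun c : code =>
    \sum_(u < L.+1) l * (w (c (m, u)) * ln (M * bin_law w c m))))).
  apply: codebook_mean_le => [|c]; first exact: card_word_gt0.
  rewrite /eve_law sum_bin_encoder /bin_law mulr_suml.
  by under eq_bigr do rewrite -mulrA.
rewrite codebook_mean_sum; apply: ler_sum => u _.
rewrite codebook_meanZ ler_wpM2l //.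
apply: le_trans (codebook_mean_bin_ln _ _ _ _ _) _.
- exact: card_word_gt0.
- by move=> x; exact: block_bsc_ge0.
- exact: sum_block_bsc_input.
apply: ler_sum => x _; rewrite ler_wpM2l ?invr_ge0 // ler_wpM2l //.
  exact: block_bsc_ge0.
exact: ln_bin_le.
Qed.

(** One-sided typicality test: [exp (- h)] is the typical likelihood and [tau] the slack. *)
Definition likely (s : states B) (x y : word N B) : bool :=
  expR (- (h + tau)) <= W s x y.

(** Only the bin is decoded, not the word in it; [ord0] is an arbitrary answer when no word passes
    the test. *)
Definition bin_decoder (c : code) (y : word N B) (s : states B * states B) :
  'I_K.+1 :=
  odflt ord0 [pick m | [exists u : 'I_L.+1, likely s.1 (c (m, u)) y]].

(** Union bound on the error event. A second likely word in the bin of [m] does no harm. *)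
Definition confusion (c : code) m s u y : R :=
  (~~ likely s (c (m, u)) y)%:R +
  \sum_(i | i.1 != m) (likely s (c i) y)%:R.

Lemma bin_decoder_error (c : code) m u y s :
  (bin_decoder c y s != m)%:R <= confusion c m s.1 u y.
Proof.
have S0 : 0 <= \sum_(i | i.1 != m) (likely s.1 (c i) y)%:R :> R.
  exact: sumr_ge0.
rewrite /bin_decoder; case: pickP => [m' /existsP[u' hu']|none] /=.
  have [_|mm'] := eqVneq m' m; first by rewrite addr_ge0.
  rewrite ler_wpDl // (bigD1 (m', u')) //= hu' lerDl.
  exact: sumr_ge0.
rewrite /confusion; have -> : likely s.1 (c (m, u)) y = false.
  by apply/negbTE; move/negbT: (none m); rewrite negb_exists => /forallP.
by rewrite ler_wpDr //; case: (_ != _).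
Qed.

(** Chebyshev's inequality before summation over [y]: failing the test forces a deviation of at
    least [tau]. The case [W = 0] is apart, since [W] equals the exponential of [loglik] only when
    positive. *)
Lemma unlikely_le s (x y : word N B) :
  W s x y * (~~ likely s x y)%:R <=
  W s x y * (loglik a b s x y + h) ^+ 2 / tau ^+ 2.
Proof.
have W0 : 0 <= W s x y by exact: block_bsc_ge0.
have t2 : 0 < tau ^+ 2 by rewrite exprn_gt0.
have r0 : 0 <= W s x y * (loglik a b s x y + h) ^+ 2 / tau ^+ 2.
  by rewrite divr_ge0 ?sqr_ge0 // mulr_ge0 ?sqr_ge0.
case: (boolP (likely s x y)) => [_|]; first by rewrite mulr0.
rewrite mulr1 /likely -ltNge => lt.
have [W00|Wn0] := eqVneq (W s x y) 0; first by rewrite W00 !mul0r.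
have Wp : 0 < W s x y by rewrite lt_def Wn0.
rewrite -mulrA ler_peMr // ler_pdivlMr // mul1r.
move: lt; rewrite (block_bsc_loglik a01 b01 Wp) ltr_expR => lt.
have tJ : tau <= - (loglik a b s x y + h).
  by rewrite -subr_ge0 (_ : _ - _ = - (h + tau) - loglik a b s x y);
    [rewrite subr_ge0 ltW|ring].
by rewrite -(sqrrN (_ + h)) ler_sqr ?nnegrE ?(le_trans (ltW tau_gt0)) // ltW.
Qed.

(** Each likely input has [W] at least [exp (- (h + tau))], and by symmetry of the channel [W] sums
    to 1 over inputs. *)
Lemma card_likely_le s (y : word N B) :
  \sum_x (likely s x y)%:R <= expR (h + tau).
Proof.
rewrite -[leRHS]mulr1 -[X in _ <= _ * X](sum_block_bsc_input a b s y) mulr_sumr.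
apply: ler_sum => x _; case: (boolP (likely s x y)) => [lk|_].
  rewrite -[leLHS](divff (lt0r_neq0 (expR_gt0 (h + tau)))).
  by rewrite ler_pM2l ?expR_gt0 // -expRN.
by rewrite mulr_ge0 ?expR_ge0 ?block_bsc_ge0.
Qed.

(** The first term is Chebyshev's bound for the sent word. For the second, each of the [L + 1] words
    in each of the [K] wrong bins passes the test with probability at most [exp (h + tau) / M]. *)
Lemma mean_error_le (q' : R) : 0 <= q' <= 1 ->
  codebook_mean (fun c : code =>
    error_prob a b q q' (bin_encoder c) (bin_decoder c))
  <= v / tau ^+ 2 + (K * L.+1)%:R * expR (h + tau) / M.
Proof.
move=> q'01.
pose l : R := L.+1%:R^-1; pose k : R := K.+1%:R^-1.
have l0 : 0 <= l by rewrite invr_ge0.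
have k0 : 0 <= k by rewrite invr_ge0.
pose E (c : code) m s := \sum_(u < L.+1) l * \sum_y W s (c (m, u)) y *
  confusion c m s u y.
apply: (@le_trans _ _ (codebook_mean (fun c : code =>
    \sum_m k * \sum_s state_prob q s * E c m s))).
  apply: codebook_mean_le => [|c]; first exact: card_word_gt0.
  apply: ler_sum => m _; rewrite -(sum_states_fst _ q') mulr_sumr.
  apply: ler_sum => s _.
  apply: (@le_trans _ _ (k * (state_prob q s.1 * state_prob q' s.2 *
      \sum_x bin_encoder c m x * \sum_y W s.1 x y *
        (bin_decoder c y s != m)%:R))).
    rewrite le_eqVlt; apply/orP; left; apply/eqP.
    rewrite [RHS]mulrA [RHS]mulr_sumr; apply: eq_bigr => x _.
    rewrite [RHS]mulrA [RHS]mulr_sumr; apply: eq_bigr => y _.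
    by rewrite /k; ring.
  rewrite ler_wpM2l // ler_wpM2l ?mulr_ge0 ?state_prob_ge0 //.
  rewrite sum_bin_encoder; apply: ler_sum => u _; rewrite ler_wpM2l //.
  apply: ler_sum => y _; rewrite ler_wpM2l ?block_bsc_ge0 //.
  exact: bin_decoder_error.
set C := (K * L.+1)%:R * _ / M.
pose V s := \sum_(x : word N B) M^-1 *
  ((\sum_y W s x y * (loglik a b s x y + h) ^+ 2) / tau ^+ 2) : R.
have conf m s u : codebook_mean (fun c : code =>
    \sum_y W s (c (m, u)) y * confusion c m s u y) <= V s + C.
  pose f x := \sum_y W s x y * (~~ likely s x y)%:R : R.
  apply: (@le_trans _ _ (codebook_mean (fun c : code => f (c (m, u)) +
      \sum_y \sum_(i | i.1 != m) W s (c (m, u)) y * (likely s (c i) y)%:R))).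
    apply: codebook_mean_le => [|c]; first exact: card_word_gt0.
    rewrite /f -big_split; apply: ler_sum => y _.
    by rewrite /confusion mulrDr mulr_sumr.
  rewrite codebook_meanD codebook_mean1 ?card_word_gt0 //; apply: lerD.
    apply: ler_sum => x _; rewrite ler_wpM2l ?invr_ge0 // mulr_suml.
    by apply: ler_sum => y _; exact: unlikely_le.
  rewrite codebook_mean_sum.
  apply: (@le_trans _ _ (\sum_(y : word N B) M^-1 * C)); last first.
    by rewrite -mulr_suml sum_uniform ?card_word_gt0 // mul1r.
  apply: ler_sum => y _; rewrite codebook_mean_sum.
  apply: (@le_trans _ _ (\sum_(i : 'I_K.+1 * 'I_L.+1 | i.1 != m)
      M^-1 * (M^-1 * expR (h + tau)))).
    (* A word of another bin is a different entry of the codebook, hence independent of the sent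
       one. *)
    apply: ler_sum => i im.
    rewrite (codebook_mean2 _ (fun x => W s x y) (fun x => (likely s x y)%:R));
      [|exact: card_word_gt0|]; last by apply: contraNneq im => <-.
    rewrite -!mulr_sumr sum_block_bsc_input // mulr1.
    by rewrite !ler_pM2l ?invr_gt0 // card_likely_le.
  set t := _ * (_ * expR _).
  have -> : \sum_(i : 'I_K.+1 * 'I_L.+1 | i.1 != m) t =
      \sum_(j | j != m) \sum_(u' < L.+1) t.
    by rewrite pair_big; apply: eq_bigl => i; rewrite andbT.
  rewrite !sumr_const cardC1 !card_ord /= -mulrnA -[leLHS]mulr_natl.
  by rewrite le_eqVlt /C /t !natrM; apply/orP; left; apply/eqP; ring.
rewrite codebook_mean_sum.
have -> : v / tau ^+ 2 + C = \sum_(m < K.+1) k * (v / tau ^+ 2 + C).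
  by rewrite sumr_const card_ord -[RHS]mulr_natl mulrA divff ?mul1r // pnatr_eq0.
apply: ler_sum => m _; rewrite codebook_meanZ ler_wpM2l // codebook_mean_sum.
apply: (@le_trans _ _ (\sum_s state_prob q s * (V s + C))).
  apply: ler_sum => s _; rewrite codebook_meanZ ler_wpM2l ?state_prob_ge0 //.
  rewrite codebook_mean_sum.
  have -> : V s + C = \sum_(u < L.+1) l * (V s + C).
    by rewrite sumr_const card_ord -[RHS]mulr_natl mulrA divff ?mul1r //
      pnatr_eq0.
  by apply: ler_sum => u _; rewrite codebook_meanZ ler_wpM2l.
under eq_bigr do rewrite mulrDr.
rewrite big_split /= -mulr_suml sum_state_prob mul1r lerD2r.
apply: (@le_trans _ _ ((\sum_(x : word N B) M^-1 *
  (\sum_s state_prob q s * \sum_y W s x y * (loglik a b s x y + h) ^+ 2))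
  / tau ^+ 2)); last by rewrite ler_wpM2r ?mean_moment // invr_ge0 sqr_ge0.
rewrite /V mulr_suml; under eq_bigr do rewrite mulr_sumr.
rewrite exchange_big le_eqVlt; apply/orP; left; apply/eqP.
apply: eq_bigr => x _; rewrite -mulrA mulr_suml mulr_sumr.
by apply: eq_bigr => s _; ring.
Qed.

End RandomBinning.

(** * Achievability *)

Section Achievability.
Context {R : realType}.
Variables (p1 p2 p1s p2s q1 q1s : R).
Hypotheses (p1_01 : 0 <= p1 <= 1) (p2_01 : 0 <= p2 <= 1).
Hypotheses (p1s_01 : 0 <= p1s <= 1) (p2s_01 : 0 <= p2s <= 1).
Hypotheses (q1_01 : 0 <= q1 <= 1) (q1s_01 : 0 <= q1s <= 1).

Lemma error_prob_ge0 N B K (enc : 'I_K -> word N B -> R) g :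
  is_encoder enc -> 0 <= error_prob p1 p2 q1 q1s enc g.
Proof.
move=> enc_ok; apply: sumr_ge0 => m _; apply: sumr_ge0 => s _.
apply: sumr_ge0 => x _; apply: sumr_ge0 => y _.
by rewrite !mulr_ge0 ?invr_ge0 ?state_prob_ge0 ?block_bsc_ge0 ?(enc_ok m).1.
Qed.

Lemma expR_le_inv (x : R) : 0 < x -> expR (- x) <= x^-1.
Proof.
move=> x0; rewrite expRN lef_pV2 ?posrE ?expR_gt0 //.
by apply: (le_trans _ (expR_ge1Dx x)); rewrite lerDr.
Qed.

Let H := mean_entropy p1 p2 q1.
Let Hs := mean_entropy p1s p2s q1s.

(* The codebook has [exp (n (Hs - H - 4 d))] bins of [exp (n (ln 2 - Hs + d))]
   codewords: each bin resolves the eavesdropper's channel, and the whole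
   codebook is below the capacity [ln 2 - H] of the main channel. *)
Lemma random_binning_mean (d : R) : 0 < d ->
  exists C : R, forall N B, (0 < N)%N -> (0 < B)%N ->
  exists K L : nat,
    expR ((N * B)%:R * (Hs - H - 4 * d)) <= K.+1%:R /\
    codebook_mean (fun c : @codebook (word N B) K L =>
      error_prob p1 p2 q1 q1s (bin_encoder c)
        (bin_decoder p1 p2 q1 ((N * B)%:R * d) c) +
      eve_divergence p1s p2s q1s (bin_encoder c) / ((N * B)%:R * ln 2))
    <= C / B%:R.
Proof.
move=> d0; have l2 := @ln2_gt0 R.
have [V mV] := loglik_moment p1_01 p2_01 q1_01.
have [Vs mVs] := loglik_moment p1s_01 p2s_01 q1s_01.
exists (V / d ^+ 2 + d^-1 + (1 + Vs / (4 * d)) / ln 2).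
move=> N B N0 B0; set n : R := (N * B)%:R.
have Np : 0 < N%:R :> R by rewrite ltr0n.
have Bp : 0 < B%:R :> R by rewrite ltr0n.
have nE : n = N%:R * B%:R by rewrite /n natrM.
have np : 0 < n by rewrite nE mulr_gt0.
have tau0 : 0 < n * d by rewrite mulr_gt0.
have nB : n^-1 <= B%:R^-1.
  by rewrite lef_pV2 ?posrE // nE ler_peMl ?ler1n ?(ltW Bp).
pose x := n * (Hs - H - 4 * d); pose y := n * ln 2 - n * Hs + n * d.
(* Since the mean entropy is at most [ln 2], [y] is nonnegative, and rounding costs at most a factor
   2: [L + 1 <= 2 exp y]. *)
have y0 : 0 <= y.
  by rewrite /y -mulrBr -mulrDr mulr_ge0 ?ltW // ltr_wpDl // subr_ge0
    mean_entropy_le.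
(* Truncation leaves at least [exp x] bins, as the rate demands, but at most [exp x] wrong ones, as
   the error bound demands. *)
exists (Num.truncn (expR x)), (Num.truncn (expR y)).
set K := Num.truncn (expR x); set L := Num.truncn (expR y).
have Kx : K%:R <= expR x by rewrite truncn_le expR_ge0.
have Ly : L.+1%:R <= 2 * expR y.
  have : L%:R <= expR y by rewrite truncn_le expR_ge0.
  have : 1 <= expR y by rewrite -expR0 ler_expR.
  by rewrite -natr1; set e := expR y; lra.
split; first exact/ltW/truncnS_gt.
rewrite codebook_meanD.
have -> : (V / d ^+ 2 + d^-1 + (1 + Vs / (4 * d)) / ln 2) / B%:R =
    (V / (B%:R * d ^+ 2) + (d^-1 / B%:R)) +
    (B%:R^-1 + Vs / (4 * (B%:R * d))) / ln 2.
  by field; rewrite !gt_eqF.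
apply: lerD.
  have := mean_error_le p1_01 p2_01 q1_01 K L tau0 (mV N B) q1s_01.
  move=> /le_trans; apply.
  apply: lerD.
    (* With [tau = n d] and second moment [V N^2 B], Chebyshev's term is [V / (B d^2)]. *)
    rewrite le_eqVlt; apply/orP; left; apply/eqP.
    by rewrite nE !natrM; field; rewrite !gt_eqF.
  rewrite card_word ler_pdivrMr ?expR_gt0 // natrM -/H -/n.
  apply: (@le_trans _ _ (expR x * (2 * expR y) * expR (n * H + n * d))).
    by rewrite ler_wpM2r ?expR_ge0 // ler_pM.
  (* The exponents add up to [n ln 2 - 2 n d]; the resulting exponential decay is weakened to the
     order [1 / B] of Chebyshev's term. *)
  have -> : expR x * (2 * expR y) * expR (n * H + n * d) =
      2 * expR (- (2 * (n * d))) * expR (n * ln 2).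
    rewrite mulrCA -!mulrA -!expRD; congr (_ * expR _).
    by rewrite /x /y; ring.
  rewrite ler_wpM2r ?expR_ge0 //.
  apply: (@le_trans _ _ (2 * (2 * (n * d))^-1)).
    by rewrite ler_wpM2l // expR_le_inv // mulr_gt0.
  have -> : 2 * (2 * (n * d))^-1 = d^-1 * n^-1 by field; rewrite !gt_eqF.
  by rewrite ler_wpM2l // invr_ge0 ltW.
rewrite (_ : (fun c => _ / _) = (fun c : @codebook (word N B) K L => (n * ln 2)^-1 *
  eve_divergence p1s p2s q1s (bin_encoder c))); last first.
  by apply/funext => c; rewrite mulrC.
rewrite codebook_meanZ mulrC.
apply: (@le_trans _ _ ((1 + Vs * (N * N * B)%:R / (4 * (n * d))) / (n * ln 2))).
  rewrite ler_wpM2r ?invr_ge0 ?(ltW (mulr_gt0 np l2)) //.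
  have := mean_divergence_le p1s_01 p2s_01 q1s_01 K tau0 (mVs N B).
  by apply; exact/ltW/truncnS_gt.
have -> : (1 + Vs * (N * N * B)%:R / (4 * (n * d))) / (n * ln 2) =
    (n^-1 + Vs / (4 * (B%:R * d))) / ln 2.
  by rewrite nE !natrM; field; rewrite !gt_eqF.
by rewrite ler_wpM2r ?invr_ge0 ?(ltW l2) // lerD2r.
Qed.

Lemma secrecy_rate_achievable :
  achievable p1 p2 p1s p2s q1 q1s ((Hs - H) / ln 2).
Proof.
move=> eps eps0 N0 B0; have l2 := @ln2_gt0 R.
(* With this [d], the rate loss of [4 d] nats is exactly [eps] bits. *)
have d0 : 0 < eps * ln 2 / 4 by rewrite divr_gt0 ?mulr_gt0.
have [C code] := random_binning_mean d0.
pose N := N0.+1; pose B := (maxn B0 (Num.truncn (C / eps))).+1.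
have [K [L [hK mean]]] := code N B isT isT.
have np : 0 < (N * B)%:R :> R by rewrite ltr0n.
have CB : C / B%:R <= eps.
  rewrite ler_pdivrMr ?ltr0n // mulrC -ler_pdivrMr //.
  apply: (le_trans (ltW (truncnS_gt _))).
  by rewrite ler_nat ltnS leq_maxr.
(* Error and divergence are nonnegative, so a single codebook whose sum is at most [eps] controls
   both. *)
have [c hc] := codebook_mean_exists (card_word_gt0 N B) (le_trans mean CB).
pose dec := bin_decoder p1 p2 q1 ((N * B)%:R * (eps * ln 2 / 4)) c.
have ok : is_encoder (bin_encoder (R := R) c) := bin_encoder_ok c.
have e0 := error_prob_ge0 dec ok.
have D0 := eve_divergence_ge0 p1s_01 p2s_01 q1s_01 ok.
have nl0 : 0 < (N * B)%:R * ln 2 :> R by rewrite mulr_gt0.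
exists N, B, K.+1, (bin_encoder c), dec.
split; split=> //.
- by rewrite ltnW // ltnS leq_maxl.
- rewrite /log2 ler_pdivlMr // ler_pdivlMr //.
  rewrite -ler_expR lnK ?posrE ?ltr0n //; apply: (le_trans _ hK).
  rewrite ler_expR le_eqVlt; apply/orP; left; apply/eqP.
  by field; rewrite gt_eqF.
- by apply: (le_trans _ hc); rewrite lerDl divr_ge0 // ltW.
- apply: (le_trans _ hc); apply: (le_trans _ (ler_wpDl e0 (lexx _))).
  rewrite ler_pdivlMr // [leLHS](_ : _ = leakage p1s p2s q1 q1s (bin_encoder c) * ln 2).
    exact: leakage_le_divergence.
  by rewrite mulrA divfK // gt_eqF.
Qed.

End Achievability.

Unset Implicit Arguments.
Set Strict Implicit.

Theorem theorem4 (R : realType) (q1 q1s p1 p1s p2 p2s : R) :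
  0 <= q1 <= 1 -> 0 <= q1s <= 1 -> q1s <= q1 ->
  0 <= p1 -> p1 <= p1s -> p1s <= p2 -> p2 <= p2s -> p2s <= 1 / 2 ->
  (((Hb p1s - Hb p1) * q1 + (Hb p2s - Hb p2) * (1 - q1s)
    + (Hb p2 - Hb p1s) * (q1 - q1s))%:E
   <= Cs_CSID p1 p2 p1s p2s q1 q1s)%E.
Proof.
move=> q1_01 q1s_01 _ p1_0 p11s p1s2 p22s p2s_half.
apply: ereal_sup_ubound; eexists; last reflexivity.
(* The terms [Hb p1s * q1] and [Hb p2 * q1s] cancel, leaving the difference of the two mean
   entropies, in bits. *)
rewrite /= (_ : _ + _ = (mean_entropy p1s p2s q1s - mean_entropy p1 p2 q1) / ln 2).
  by apply: secrecy_rate_achievable => //; apply/andP; split; lra.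
by rewrite /mean_entropy; field; rewrite gt_eqF // ln2_gt0.
Qed.
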